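(* Let $\mathscr T^+$ be the set of $(t,\omega)\in[0,T]\times\Omega$ such that $\nu(\{x:\psi_t(x)<0\})=0$, and $\mathscr T^-$ the set of $(t,\omega)$ such that $\nu(\{x:\psi_t(x)>0\})=0$. Assume (1) $\varphi_t<\int_{\mathbb R^*}\psi_t(x)\,\nu(dx)$ for all $(t,\omega)\in\mathscr T^+$; (2) $\varphi_t>\int_{\mathbb R^*}\psi_t(x)\,\nu(dx)$ for all $(t,\omega)\in\mathscr T^-$. Then for every $u\in\mathrm L^2(\nu)\cap\mathrm L^\infty(\nu)$ and every $t\in[0,T]$ (and $\omega$), the function $\lambda:\mathcal C\to\mathbb R$, $$\lambda(\pi)=\int_{\mathbb R^*}g_\alpha\big(u(x)-\pi\psi_t(x)\big)\,\nu(dx)-\pi\varphi_t,$$ admits a minimum in $\mathcal C$. If $\mathcal C=\mathbb R$, the minimum is unique.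
   Context: Setting: $T>0$; $\nu$ is a positive measure on $\mathbb R^*=\mathbb R\setminus\{0\}$ with $\nu(\{0\})=0$ and $\int(1\wedge|x|^2)\nu(dx)<\infty$ (the Lévy measure of a Poisson point process on a filtered probability space $(\Omega,\mathcal F,(\mathcal F_t),\mathbb P)$ which, together with an independent Brownian motion, generates the filtration). $\varphi=(\varphi_t)$ is a uniformly bounded predictable real process and $\psi=\psi_t(x)$ is a uniformly bounded predictable (i.e. $\mathcal P\otimes\mathcal B(\mathbb R^* )$-measurable) process with $\mathbb E\int_0^T\int\psi_t(x)^2\nu(dx)dt<\infty$ and $\psi>-1$. $\alpha>0$ and $g_\alpha(y)=\frac{e^{\alpha y}-\alpha y-1}{\alpha}$. $\mathcal C\subseteq\mathbb R$ is a closed set with $0\in\mathcal C$. $\mathrm L^2(\nu)$ and $\mathrm L^\infty(\nu)$ denote measurable $u:\mathbb R\to\mathbb R$ that are square-integrable w.r.t. $\nu$, resp. $\nu$-a.e. bounded. *)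

(* Defs.v *)
From HB Require Import structures.
From mathcomp Require Import all_boot all_order all_algebra.
From mathcomp Require Import all_classical all_reals all_analysis.
Set Implicit Arguments. Unset Strict Implicit. Unset Printing Implicit Defensive.
Import Order.TTheory GRing.Theory Num.Theory.
Import numFieldNormedType.Exports.
Local Open Scope classical_set_scope.
Local Open Scope ring_scope.

Definition g_alpha {R : realType} (alpha y : R) : R :=
  (expR (alpha * y) - alpha * y - 1) / alpha.

Definition Rstar {R : realType} : set R := [set~ 0%R].

(* the function lambda(pi) = \int_{R^*} g_alpha(u(x) - pi psi(x)) nu(dx) - pi phi,
   valued in the extended reals (the integral of a nonnegative function). *)
Definition lambda_fun {R : realType} (nu : {measure set R -> \bar R})
  (alpha : R) (u psi : R -> R) (phi : R) (p : R) : \bar R :=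
  (\int[nu]_(x in Rstar) (g_alpha alpha (u x - p * psi x))%:E - (p * phi)%:E)%E.

(* Main.v *)
Require Import Defs.
From HB Require Import structures.
From mathcomp Require Import all_boot all_order all_algebra.
From mathcomp Require Import all_classical all_reals all_analysis.
From mathcomp Require Import measurable_realfun.
From mathcomp Require Import ring lra.
Import Order.TTheory GRing.Theory Num.Theory.
Import numFieldNormedType.Exports.
Local Open Scope classical_set_scope.
Local Open Scope ring_scope.

(** Write [lambda p = G p - p phi] with [G p = \int g_alpha (u - p psi) >= 0].
    By Fatou [G] is lower semicontinuous, so a minimum over a closed set exists
    as soon as [lambda] grows linearly at [+oo] and [-oo].  For every slope
    [L >= -1], [g_alpha] has an affine minorant of slope [L]; integrating it
    over a set [A] of finite measure on which [u] and [psi] are bounded gives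
    [lambda p >= (- L \int_A psi - phi) p - c].  If [psi < 0] on a non-null set,
    take [A] inside it and [L] large; otherwise take [L = -1] and let [A] exhaust
    [R^*], so that [\int_A psi] eventually exceeds [phi] by assumption (1).
    The other direction is the same statement for [-psi] and [-phi].
    Uniqueness is strict convexity: if [psi] vanished a.e., then (1) and (2)
    would both apply and contradict each other. *)

(** * Pointwise estimates for the exponential penalty [g_alpha] *)

Section g_alpha_theory.
Context {R : realType}.
Implicit Types alpha y L : R.

Lemma g_alpha_ge0 alpha y : 0 < alpha -> 0 <= g_alpha alpha y.
Proof.
move=> a0; rewrite /g_alpha divr_ge0 ?(ltW a0)//.
by have := expR_ge1Dx (alpha * y); lra.
Qed.

(** For [L > -1] the minorant is the tangent line at the point where [g_alpha] has slope [L], namely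
    [expR (alpha * y) = 1 + L]. The slope [-1] is that of the asymptote at [-oo], where positivity
    of [expR] is enough. *)
Lemma g_alpha_ge_affine alpha L : 0 < alpha -> -1 <= L ->
  exists c, forall y, L * y - c <= g_alpha alpha y.
Proof.
move=> a0; rewrite le_eqVlt => /predU1P[<-|L1].
  exists alpha^-1 => y; rewrite /g_alpha ler_pdivlMr//.
  have -> : (-1 * y - alpha^-1) * alpha = - (alpha * y) - 1.
    by field; rewrite gt_eqF.
  by have := expR_ge0 (alpha * y); lra.
have L0 : 0 < 1 + L by lra.
pose l := ln (1 + L).
exists ((1 - (1 + L) * (1 - l)) / alpha) => y; rewrite /g_alpha ler_pdivlMr//.
have -> : expR (alpha * y) = (1 + L) * expR (alpha * y - l).
  by rewrite expRD expRN lnK ?posrE// mulrCA mulfV ?mulr1// gt_eqF.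
have -> : (L * y - (1 - (1 + L) * (1 - l)) / alpha) * alpha =
    (1 + L) * (1 + (alpha * y - l)) - alpha * y - 1.
  by field; rewrite gt_eqF.
by rewrite !lerB// ler_wpM2l ?(ltW L0)// expR_ge1Dx.
Qed.

(** From [expR x - 1 <= x * expR x] one gets [expR x - 1 - x <= x * (expR x - 1)]; a second tangent
    bound, chosen by the sign of [x], produces the square. *)
Lemma expR_sub_affine_le (x : R) : expR x - x - 1 <= expR `|x| * x ^+ 2.
Proof.
have h1 := expR_ge1Dx x.
have h2 : expR x - 1 <= x * expR x.
  have := ler_wpM2l (expR_ge0 x) (expR_ge1Dx (- x)).
  by rewrite -expRD subrr expR0; lra.
have [x0|x0] := leP 0 x.
  by rewrite ger0_norm//; nra.
rewrite ltr0_norm//.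
have : 1 <= expR (- x) by have := expR_ge1Dx (- x); lra.
have : expR x - 1 - x <= x * (expR x - 1) by nra.
nra.
Qed.

Lemma g_alpha_le_sqr alpha M y : 0 < alpha -> `|y| <= M ->
  g_alpha alpha y <= expR (alpha * M) * alpha * y ^+ 2.
Proof.
move=> a0 yM; rewrite /g_alpha ler_pdivrMr//.
apply: (le_trans (expR_sub_affine_le _)).
rewrite exprMn.
have -> : expR (alpha * M) * alpha * y ^+ 2 * alpha =
  expR (alpha * M) * (alpha ^+ 2 * y ^+ 2) by ring.
apply: ler_wpM2r; first by rewrite mulr_ge0// sqr_ge0.
by rewrite ler_expR normrM gtr0_norm// ler_pM2l.
Qed.

(** Strict convexity as an exact identity: the convexity defect is a square, vanishing only when
    [a = b], and it can be integrated without any limit argument. *)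
Lemma g_alpha_midpoint alpha a b : 0 < alpha ->
  g_alpha alpha a + g_alpha alpha b =
  2 * g_alpha alpha ((a + b) / 2) +
  (expR (alpha * a / 2) - expR (alpha * b / 2)) ^+ 2 / alpha.
Proof.
move=> a0; rewrite /g_alpha.
have -> : expR (alpha * a) = expR (alpha * a / 2) ^+ 2.
  by rewrite expr2 -expRD -splitr.
have -> : expR (alpha * b) = expR (alpha * b / 2) ^+ 2.
  by rewrite expr2 -expRD -splitr.
have -> : expR (alpha * ((a + b) / 2)) =
    expR (alpha * a / 2) * expR (alpha * b / 2).
  by rewrite -expRD; congr expR; field.
by field; rewrite gt_eqF.
Qed.

Lemma g_alpha_continuous alpha : continuous (g_alpha alpha : R -> R).
Proof.
move=> y; apply: cvgMl; apply: cvgB; last exact: cvg_cst.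
apply: cvgB; last by apply: cvgM; [exact: cvg_cst|exact: cvg_id].
apply: (@continuous_comp _ _ _ ( *%R alpha) expR); last exact: continuous_expR.
by apply: cvgM; [exact: cvg_cst|exact: cvg_id].
Qed.

End g_alpha_theory.

(** * The direct method on a closed subset of the line *)

(** A minimizing sequence is bounded by coercivity, so Bolzano-Weierstrass extracts a limit in [C].
    Semicontinuity is only required along sequences whose values converge to a real number, which
    suffices because the infimum is finite. *)
Lemma coercive_has_minimum {R : realType} (Phi : R -> \bar R) (C : set R) (b c : R) :
  closed C -> C 0 -> (Phi 0%R < +oo)%E -> 0 < b ->
  (forall p, ((b * `|p| - c)%:E <= Phi p)%E) ->
  (forall (p_ : R^nat) p l, p_ @ \oo --> p -> (Phi \o p_) @ \oo --> l%:E ->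
    (Phi p <= l%:E)%E) ->
  exists p0, C p0 /\ forall p, C p -> (Phi p0 <= Phi p)%E.
Proof.
move=> clC C0 Phi0 b0 coer lsc.
pose m := ereal_inf (Phi @` C).
have m_fin : m \is a fin_num.
  rewrite fin_numElt; apply/andP; split.
    apply: (@lt_le_trans _ _ (- c)%:E); first exact: ltNyr.
    apply: le_ereal_inf_tmp => _ [p _ <-]; apply: le_trans (coer p).
    by rewrite lee_fin lerDr mulr_ge0// ltW.
  by apply: le_lt_trans Phi0; apply: ereal_inf_lbound; exists 0.
have [M mM] : exists M, m = M%:E by exists (fine m); rewrite fineK.
have /choice[p_ p_P] (n : nat) : exists p, C p /\ (Phi p < m + n.+1%:R^-1%:E)%E.
  have [_ [p Cp <-] pm] := @lb_ereal_inf_adherent _ (Phi @` C) n.+1%:R^-1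
    ltac:(by []) m_fin.
  by exists p.
have [s [s_incr s_cvg]] : exists s : nat -> nat,
    increasing_seq s /\ cvgn (p_ \o s).
  suff /bolzano_weierstrass[s] : bounded_fun p_ by exists s.
  (* The values stay below [M + 1], since [n.+1%:R^-1 <= 1]; solving [b * |p| - c <= M + 1] gives
     this radius. *)
  exists ((M + 1 + c) / b); split; first exact: num_real.
  move=> B mB n _ /=; apply: le_trans (ltW mB).
  have bp : b * `|p_ n| <= M + 1 + c.
    have := le_lt_trans (coer (p_ n)) (p_P n).2.
    rewrite mM -EFinD lte_fin ltrBlDr => /ltW/le_trans; apply.
    by rewrite lerD2r lerD2l invf_le1// ler1n.
  by rewrite ler_pdivlMr// mulrC.
exists (limn (p_ \o s)); split.
  apply: (@closed_cvg _ _ _ eventually_filter (p_ \o s) C clC _ _ s_cvg).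
  by apply: nearW => n; exact: (p_P _).1.
suff le_m : (Phi (limn (p_ \o s)) <= m)%E.
  by move=> p Cp; apply: (le_trans le_m); apply: ereal_inf_lbound; exists p.
rewrite mM; apply: lsc s_cvg _; rewrite -mM.
apply: (@squeeze_cvge _ _ _ _ (cst m) _
  (fun n => (m + n.+1%:R^-1%:E)%E)); last 2 first.
- exact: cvg_cst.
- rewrite -[X in _ --> X]adde0; apply: cvgeD => //.
  + by rewrite fin_num_adde_defr.
  + exact: cvg_cst.
  + by apply: cvg_EFin; [exact: nearW|exact: cvg_harmonic].
apply: nearW => n; apply/andP; split.
  by apply: ereal_inf_lbound; exists (p_ (s n)) => //; exact: (p_P _).1.
apply: le_trans (ltW (p_P (s n)).2) _; rewrite leeD2l// lee_fin.
(* An increasing [s] satisfies [n <= s n], so the error along the subsequence is still at most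
   [1 / (n + 1)]. *)
have le_ns : (n <= s n)%N by exact: unstable.mono_leq_infl.
by rewrite lef_pV2 ?posrE// ler_nat ltnS.
Qed.

(** * Semicontinuity and linear growth of the integral over a general measure space *)

Section exponential_risk.
Context d (T : measurableType d) (R : realType) (mu : {measure set T -> \bar R}).
Variables (D : set T) (alpha : R).
Hypotheses (mD : measurable D) (alpha_gt0 : 0 < alpha).
Implicit Types (u f : T -> R) (p phi L : R).

Let G u f p := (\int[mu]_(x in D) (g_alpha alpha (u x - p * f x))%:E)%E.

Lemma measurable_g_alpha A u f p : measurable_fun A u -> measurable_fun A f ->
  measurable_fun A (fun x => (g_alpha alpha (u x - p * f x))%:E).
Proof.
move=> mu_ mf; apply/measurable_EFinP.
apply: (@measurableT_comp _ _ _ _ _ _ (g_alpha alpha)).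
  by apply: continuous_measurable_fun; exact: g_alpha_continuous.
by apply: measurable_funB => //; apply: measurable_funM.
Qed.

Lemma integral_g_alpha_lsc u f (p_ : R^nat) p (l : R) :
  measurable_fun D u -> measurable_fun D f ->
  p_ @ \oo --> p -> (G u f \o p_) @ \oo --> l%:E -> (G u f p <= l%:E)%E.
Proof.
move=> mu_ mf p_p Gl; rewrite -(cvg_limn_einf_sup Gl).1.
pose h n x := (g_alpha alpha (u x - p_ n * f x))%:E.
apply: le_trans (fatou mu mD (f := h) _ _); last 2 first.
- by move=> n; exact: measurable_g_alpha.
- by move=> n x _; rewrite lee_fin g_alpha_ge0.
rewrite le_eqVlt; apply/orP; left; apply/eqP; apply: eq_integral => x _.
suff /cvg_limn_einf_sup -> : h n x @[n --> \oo] -->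
  (g_alpha alpha (u x - p * f x))%:E by [].
apply: cvg_EFin; first exact: nearW.
apply: (@continuous_cvg _ _ _ _ _ _ (g_alpha alpha)).
  exact: g_alpha_continuous.
by apply: cvgB; [exact: cvg_cst|apply: cvgM => //; exact: cvg_cst].
Qed.

(** The affine minorant of slope [L] is integrated over [A]. Finite measure and boundedness make it
    integrable, and the term [L * u] is absorbed into the constant [k] through [|u| <= N]. *)
Lemma integral_g_alpha_ge A u f L (N I : R) : measurable A -> A `<=` D ->
  (mu A < +oo)%E -> measurable_fun D u -> measurable_fun D f ->
  (forall x, A x -> `|u x| <= N) -> (forall x, A x -> `|f x| <= N) ->
  (\int[mu]_(x in A) (f x)%:E = I%:E)%E -> -1 <= L ->
  exists c, forall p, ((- (L * I) * p - c)%:E <= G u f p)%E.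
Proof.
move=> mA AD muA mu_ mf uN fN fI L1.
have [c0 gc0] := g_alpha_ge_affine _ _ alpha_gt0 L1.
exists ((`|L| * N + c0) * fine (mu A)) => p.
set k := `|L| * N + c0.
have mfA : measurable_fun A f by exact: measurable_funS mf.
have fint : mu.-integrable A (EFin \o f).
  apply: measurable_bounded_integrable => //.
  exists N; split; first exact: num_real.
  by move=> B /ltW NB x /fN fxN; exact: le_trans NB.
have kint : mu.-integrable A (EFin \o cst k).
  apply: (@measurable_bounded_integrable _ _ _ _ (cst k)) => //.
  by exists `|k|; split; [exact: num_real|move=> B /ltW kB x _].
(* Once [G u f p] is finite, the integrand is integrable on [A] and can be compared with a minorant
   of variable sign. *)
have [->|Gfin] := eqVneq (G u f p) +oo%E; first exact: leey.
have GA : (\int[mu]_(x in A) (g_alpha alpha (u x - p * f x))%:E <= G u f p)%E.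
  apply: ge0_subset_integral => //; first exact: measurable_g_alpha.
  by move=> x _; rewrite lee_fin g_alpha_ge0.
apply: (le_trans _ GA).
have mg : measurable_fun A (fun x => (g_alpha alpha (u x - p * f x))%:E).
  by apply: measurable_g_alpha => //; exact: measurable_funS mu_.
have gint : mu.-integrable A (fun x => (g_alpha alpha (u x - p * f x))%:E).
  apply/integrableP; split=> //.
  apply: le_lt_trans (_ : (G u f p < +oo)%E); last by rewrite lt_neqAle Gfin leey.
  by under eq_integral do rewrite gee0_abs ?lee_fin ?g_alpha_ge0//.
have -> : ((- (L * I) * p - k * fine (mu A))%:E =
  \int[mu]_(x in A) ((- (L * p))%:E * (f x)%:E - k%:E))%E.
  rewrite integralB//; last first.
    exact: integrableZl.
  rewrite integralZl// fI integral_cst// -[mu A]fineK; last first.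
    by rewrite ge0_fin_numE.
  by rewrite -!EFinM -EFinB; congr EFin; ring.
apply: le_integral => //.
  by apply: integrableB => //; exact: integrableZl.
move=> x /set_mem Ax; rewrite -EFinM -EFinB lee_fin.
apply: le_trans (gc0 _).
have : - (`|L| * N) <= L * u x.
  rewrite lerNl (le_trans (ler_norm _))// normrN normrM.
  by rewrite ler_wpM2l// uN.
by rewrite /k; lra.
Qed.

(** * Growth at [+oo] by exhausting the domain with sets of finite measure *)

Section exhaustion.
Variables (E : (set T)^nat) (u f : T -> R) (K : R).
Hypotheses (mE : forall n, measurable (E n)) (E_fin : forall n, (mu (E n) < +oo)%E)
  (E_mono : {homo E : m n / (m <= n)%N >-> m `<=` n})
  (E_cover : \bigcup_n E n = D) (mu_ : measurable_fun D u) (mf : measurable_fun D f)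
  (u_bnd : forall n x, E n x -> `|u x| <= n%:R)
  (f_bnd : forall x, D x -> `|f x| <= K).

Let subE n x : E n x -> D x.
Proof. by rewrite -E_cover => Ex; exists n. Qed.

(** Here [S] will be a sign set of [f]. As [f] is measurable on [D] only, [S] itself need not be
    measurable. *)
Let mES n S : measurable (D `&` S) -> measurable (E n `&` S).
Proof.
move=> mS; rewrite (_ : E n `&` S = E n `&` (D `&` S)); first exact: measurableI.
by rewrite setIA; congr setI; apply/esym/setIidPl => x /subE.
Qed.

Let integral_f_fin n S : measurable (D `&` S) ->
  exists I : R, (\int[mu]_(x in E n `&` S) (f x)%:E = I%:E)%E.
Proof.
move=> mS; exists (fine (\int[mu]_(x in E n `&` S) (f x)%:E)%E).
rewrite fineK//; apply: integrable_fin_num; first exact: mES.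
apply: (@measurable_bounded_integrable _ _ _ _ f); first exact: mES.
- apply: le_lt_trans (E_fin n); apply: le_measure; rewrite ?inE//.
  exact: mES.
- by apply: measurable_funS mf => // x [] /subE.
- exists K; split; first exact: num_real.
  move=> B /ltW KB x [/subE/f_bnd fxK _]; exact: le_trans KB.
Qed.

(** By monotone convergence, if every integral over [E n] were at most [a], so would be the full
    integral. *)
Lemma integral_exhaustion_gt (S : set T) (h : T -> R) (a : R) :
  measurable (D `&` S) -> measurable_fun D h ->
  (forall x, D x -> S x -> 0 <= h x) ->
  (a%:E < \int[mu]_(x in D `&` S) (h x)%:E)%E ->
  exists n, (a%:E < \int[mu]_(x in E n `&` S) (h x)%:E)%E.
Proof.
move=> mS mh h0 a_lt; apply/not_existsP => n_le.
have sub n x : (E n `&` S) x -> (D `&` S) x by case=> /subE.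
have := @ge0_nondecreasing_set_cvg_integral _ _ R (fun n => E n `&` S)
  (EFin \o h) mu.
rewrite -setI_bigcupl E_cover => cv.
suff : (\int[mu]_(x in D `&` S) (h x)%:E <= a%:E)%E by rewrite leNgt a_lt.
apply: (@closed_cvg _ _ _ eventually_filter _ _ (@closed_ereal_ge_ereal _ a%:E) _ _ (cv _ _ _ _)).
- by apply: nearW => n /=; rewrite leNgt; apply/negP; exact: n_le.
- by move=> m n mn; apply/subsetPset; apply: setSI; exact: E_mono.
- by move=> n; exact: mES.
- by move=> n; apply/measurable_EFinP; apply: measurable_funS mh => // x /sub[].
- by move=> n x /sub[Dx Sx]; rewrite lee_fin h0.
Qed.

(** The hypothesis integrates [f] over its nonnegativity set, so that the integral is one of a
    nonnegative function, possibly [+oo], and monotone convergence applies. *)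
Lemma integral_g_alpha_coercive_right phi :
  (mu (D `&` [set x | f x < 0]) = 0%E ->
    (phi%:E < \int[mu]_(x in D `&` [set x | (0 <= f x)%R]) (f x)%:E)%E) ->
  exists b c, 0 < b /\ forall p, ((b * p - c)%:E <= G u f p - (p * phi)%:E)%E.
Proof.
move=> hphi.
have mlt : measurable (D `&` [set x | f x < 0]).
  by have := mf mD _ (measurable_itv `]-oo, (0:R)[); rewrite preimage_itvNyo.
have mge : measurable (D `&` [set x | 0 <= f x]).
  by have := mf mD _ (measurable_itv `[(0:R), +oo[); rewrite preimage_itvcy.
(* It remains to find a piece and a slope with [phi < - (L * I)]: the growth rate is then
   [b = - (L * I) - phi]. *)
suff [n [S [L [I [mS L1 SI phiL]]]]] : exists n S L I,
    [/\ measurable (D `&` S), -1 <= L,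
      (\int[mu]_(x in E n `&` S) (f x)%:E = I%:E)%E & phi < - (L * I)].
  have [||||c ge_c] := @integral_g_alpha_ge (E n `&` S) u f L
      (Num.max n%:R K) I (mES _ _ mS) _ _ mu_ mf _ _ SI L1.
  - by move=> x [/subE].
  - apply: le_lt_trans (E_fin n); apply: le_measure; rewrite ?inE//.
    exact: mES.
  - by move=> x [/u_bnd uxn _]; rewrite le_max uxn.
  - by move=> x [/subE/f_bnd fxK _]; rewrite le_max fxK orbT.
  exists (- (L * I) - phi), c; split; first by rewrite subr_gt0.
  move=> p; rewrite leeBrDr// -EFinD.
  apply: le_trans (ge_c p); rewrite lee_fin; lra.
have [/hphi/integral_exhaustion_gt[]//|] :=
    eqVneq (mu (D `&` [set x | f x < 0])) 0%E.
  move=> n; have [I SI] := integral_f_fin n _ mge.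
  rewrite SI lte_fin => phiI.
  by exists n, [set x | 0 <= f x], (-1), I; split=> //; lra.
move=> mu_neq0.
have [|||n] := @integral_exhaustion_gt [set x | f x < 0] (fun x => - f x) 0 mlt.
- exact: measurableT_comp.
- by move=> x _ /= fx0; rewrite oppr_ge0 ltW.
- rewrite lt_neqAle integral_ge0 ?andbT; last first.
    by move=> x [_ /= fx0]; rewrite lee_fin oppr_ge0 ltW.
  (* A zero integral of [- f] over the set where [f < 0] would force [f = 0] almost everywhere on
     it, making that set null. *)
  apply: contra mu_neq0 => /eqP int0.
  apply/eqP; apply: measure_negligible => //.
  have mNf : measurable_fun (D `&` [set x | f x < 0]) (EFin \o (fun x => - f x)).
    apply/measurable_EFinP; apply: measurable_funS (_ : measurable_fun D _) => //.
    exact: measurableT_comp.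
  have [+ _] := ae_eq_integral_abs mu mlt mNf.
  under eq_integral => x /set_mem[_ /= fx0] do
    rewrite gtr0_norm ?oppr_gt0//.
  move=> /(_ (esym int0)); apply: negligibleS => x [Dx /= fx0] /=.
  by move=> /(_ (conj Dx fx0)) [] /eqP; rewrite oppr_eq0 lt_eqF.
have [I SI] := integral_f_fin n _ mlt.
have SN : (\int[mu]_(x in E n `&` [set x | (f x < 0)%R]) (- f x)%:E = (- I)%:E)%E.
  rewrite EFinN -SI -[LHS]oppeK -integral_ge0N; last first.
    by move=> x [_ /= fx0]; rewrite lee_fin oppr_ge0 ltW.
  by congr (- _)%E; apply: eq_integral => x _; rewrite EFinN oppeK.
rewrite SN lte_fin oppr_gt0 => I0.
(* Since [I < 0], this slope is nonnegative, and it gives [- (L * I) = |phi| + 1 > phi]. *)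
exists n, [set x | f x < 0], (- (`|phi| + 1) / I), I; split=> //.
  rewrite mulNr -mulrN -invrN.
  apply: (@le_trans _ _ 0); first by lra.
  by rewrite divr_ge0 ?addr_ge0// oppr_ge0 ltW.
rewrite divfK ?lt_eqF// opprK.
by have := ler_norm phi; lra.
Qed.

End exhaustion.
End exponential_risk.

(** * Uniqueness and existence of minimizers over a general measure space *)

Section Lambda.
Context d (T : measurableType d) (R : realType) (mu : {measure set T -> \bar R}).
Variables (D : set T) (alpha : R) (u f : T -> R) (phi : R).
Hypotheses (mD : measurable D) (alpha_gt0 : 0 < alpha)
  (mu_ : measurable_fun D u) (mf : measurable_fun D f).

Let G p := (\int[mu]_(x in D) (g_alpha alpha (u x - p * f x))%:E)%E.
Let Lam p := (G p - (p * phi)%:E)%E.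
Hypothesis G0_fin : (G 0%R < +oo)%E.

Let G_ge0 p : (0 <= G p)%E.
Proof. by apply: integral_ge0 => x _; rewrite lee_fin g_alpha_ge0. Qed.

Let mg p : measurable_fun D (fun x => (g_alpha alpha (u x - p * f x))%:E).
Proof. exact: measurable_g_alpha. Qed.

(** At the midpoint [q] of two minimizers, the integrated defect [h] must vanish by minimality.
    Hence [h = 0] almost everywhere, that is [(p2 - p1) * f = 0] almost everywhere. *)
Lemma Lambda_minimizer_unique p1 p2 : mu (D `&` [set x | f x != 0]) != 0%E ->
  (forall p, (Lam p1 <= Lam p)%E) -> (forall p, (Lam p2 <= Lam p)%E) -> p1 = p2.
Proof.
move=> f_neq0 min1 min2; apply/eqP; apply: contraNT f_neq0 => p12.
(* Comparison with the finite value [Lam 0] makes [G] finite at a minimizer, which excludes the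
   infinite cases in the arithmetic below. *)
have minimizer_fin p : (forall q, (Lam p <= Lam q)%E) ->
    exists a, G p = a%:E.
  move=> /(_ 0%R); rewrite /Lam mul0r sube0 leeBlDr// => Gp.
  exists (fine (G p)); rewrite fineK// ge0_fin_numE//.
  by apply: (le_lt_trans Gp); rewrite lte_add_pinfty// ltry.
have [a1 Ga1] := minimizer_fin _ min1.
have [a2 Ga2] := minimizer_fin _ min2.
pose q := (p1 + p2) / 2.
pose h x := (expR (alpha * (u x - p1 * f x) / 2) -
             expR (alpha * (u x - p2 * f x) / 2)) ^+ 2 / alpha.
have h_ge0 x : 0 <= h x by rewrite divr_ge0 ?sqr_ge0 ?ltW.
have mh : measurable_fun D h.
  have mexp p : measurable_fun D (fun x => expR (alpha * (u x - p * f x) / 2)).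
    apply: measurableT_comp => //; apply: measurable_funM => //.
    apply: measurable_funM => //; apply: measurable_funB => //.
    exact: measurable_funM.
  apply: measurable_funM => //; apply: measurable_funX.
  exact: measurable_funB.
have midpoint : (G p1 + G p2 = 2%:E * G q + \int[mu]_(x in D) (h x)%:E)%E.
  rewrite -ge0_integralD//; last 2 first.
    by move=> x _; rewrite lee_fin g_alpha_ge0.
    by move=> x _; rewrite lee_fin g_alpha_ge0.
  rewrite -ge0_integralZl_EFin//; last first.
    by move=> x _; rewrite lee_fin g_alpha_ge0.
  rewrite -ge0_integralD//; last 4 first.
  - by move=> x _; rewrite -EFinM lee_fin mulr_ge0// g_alpha_ge0.
  - exact: emeasurable_funM.
  - by move=> x _; rewrite lee_fin.
  - exact/measurable_EFinP.
  apply: eq_integral => x _; rewrite -EFinM -!EFinD g_alpha_midpoint//.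
  by congr (2 * g_alpha _ _ + _)%:E; rewrite /q; field.
have h0 : (\int[mu]_(x in D) (h x)%:E = 0)%E.
  move: midpoint (min1 q) (min2 q); rewrite /Lam Ga1 Ga2 -EFinD.
  have := G_ge0 q.
  have : (0 <= \int[mu]_(x in D) (h x)%:E)%E.
    by apply: integral_ge0 => x _; rewrite lee_fin.
  case: (\int[mu]_(x in D) (h x)%:E)%E => [i i0||//]; last first.
    by case: (G q) => [c||//] _ _; rewrite ?gt0_muley ?lte_fin// -EFinM.
  case: (G q) => [c _||//]; last by rewrite gt0_muley ?lte_fin.
  rewrite -EFinM -!EFinB -EFinD !lee_fin /q => -[sum] m1 m2.
  rewrite lee_fin in i0.
  by congr EFin; apply/eqP; rewrite eq_le i0 andbT; lra.
have mfn : measurable (D `&` [set x | f x != 0]).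
  rewrite (_ : [set x | f x != 0] = f @^-1` [set~ 0]).
    by apply: mf => //; apply: measurableC; exact: measurable_set1.
  by apply/seteqP; split => x /eqP.
apply/eqP; apply: measure_negligible => //.
have [+ _] := ae_eq_integral_abs mu mD (proj2 (measurable_EFinP _ _) mh).
under eq_integral do rewrite gee0_abs ?lee_fin//.
move=> /(_ h0); apply: negligibleS => x [Dx /= fx0] /= /(_ Dx) [].
move=> /eqP; rewrite /h mulf_eq0 invr_eq0 (gt_eqF alpha_gt0) orbF.
rewrite sqrf_eq0 subr_eq0 => /eqP/expR_inj/eqP.
rewrite -subr_eq0.
have -> : alpha * (u x - p1 * f x) / 2 - alpha * (u x - p2 * f x) / 2 =
  alpha / 2 * ((p2 - p1) * f x) by ring.
rewrite !mulf_eq0 subr_eq0 invr_eq0 pnatr_eq0 (gt_eqF alpha_gt0).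
by rewrite [p2 == p1]eq_sym (negbTE p12) (negbTE fx0).
Qed.

Variables (E : (set T)^nat) (K : R).
Hypotheses (mE : forall n, measurable (E n)) (E_fin : forall n, (mu (E n) < +oo)%E)
  (E_mono : {homo E : m n / (m <= n)%N >-> m `<=` n})
  (E_cover : \bigcup_n E n = D)
  (u_bnd : forall n x, E n x -> `|u x| <= n%:R)
  (f_bnd : forall x, D x -> `|f x| <= K).

Lemma Lambda_has_minimum (C : set R) : closed C -> C 0 ->
  (mu (D `&` [set x | f x < 0]) = 0%E ->
    (phi%:E < \int[mu]_(x in D `&` [set x | (0 <= f x)%R]) (f x)%:E)%E) ->
  (mu (D `&` [set x | 0 < f x]) = 0%E ->
    (\int[mu]_(x in D `&` [set x | (f x <= 0)%R]) (f x)%:E < phi%:E)%E) ->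
  exists p0, C p0 /\ forall p, C p -> (Lam p0 <= Lam p)%E.
Proof.
move=> clC C0 hpos hneg.
have [b1 [c1 [b1_gt0 ge1]]] := integral_g_alpha_coercive_right _ _ _ mu _ alpha mD
  alpha_gt0 E u f K mE E_fin E_mono E_cover mu_ mf u_bnd f_bnd phi hpos.
have mNf : measurable_fun D (fun x => - f x) by exact: measurableT_comp.
have Nf_bnd x : D x -> `|- f x| <= K by rewrite normrN; exact: f_bnd.
have [|b2 [c2 [b2_gt0 ge2]]] := integral_g_alpha_coercive_right _ _ _ mu _ alpha mD
  alpha_gt0 E u _ K mE E_fin E_mono E_cover mu_ mNf u_bnd Nf_bnd (- phi).
  have -> : [set x | - f x < 0] = [set x | 0 < f x].
    by apply/funext => x /=; rewrite oppr_lt0.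
  have -> : [set x | 0 <= - f x] = [set x | f x <= 0].
    by apply/funext => x /=; rewrite oppr_ge0.
  move=> /hneg lt_phi; rewrite EFinN lteNl -integral_ge0N; last first.
    by move=> x [_ /= fx0]; rewrite lee_fin oppr_ge0.
  by under eq_integral do rewrite EFinN oppeK.
apply: (@coercive_has_minimum _ _ _ (Num.min b1 b2) (Num.max c1 c2)) => //.
- by rewrite /Lam mul0r sube0.
- by rewrite lt_min b1_gt0.
- move=> p; have [p0|p0] := leP 0 p.
    apply: le_trans (ge1 p); rewrite lee_fin ger0_norm//.
    apply: lerB; last by rewrite le_max lexx.
    by apply: ler_wpM2r => //; rewrite ge_min lexx.
  (* For [p < 0], changing the signs of [p], [f] and [phi] together leaves [Lam] unchanged and turns
     growth at [-oo] into growth at [+oo]. *)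
  have -> : Lam p = (\int[mu]_(x in D) (g_alpha alpha (u x - (- p) * (- f x)))%:E
      - (- p * - phi)%:E)%E.
    rewrite /Lam mulrNN; congr (_ - _)%E.
    by apply: eq_integral => x _; rewrite mulrNN.
  apply: le_trans (ge2 (- p)); rewrite lee_fin ltr0_norm//.
  apply: lerB; last by rewrite le_max lexx orbT.
  by apply: ler_wpM2r; [rewrite oppr_ge0 ltW|rewrite ge_min lexx orbT].
move=> p_ p l p_p Lam_l; rewrite /Lam leeBlDr//.
apply: (@integral_g_alpha_lsc _ _ _ mu D alpha mD alpha_gt0 u f p_ p (l + p * phi)) => //.
(* The linear term is continuous in [p], so convergence of [Lam] along [p_] yields that of [G], to
   [l + p * phi]. *)
have -> : G \o p_ = ((Lam \o p_) \+ (fun n => (p_ n * phi)%:E))%E.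
  by apply/funext => n /=; rewrite /Lam subeK.
rewrite EFinD; apply: cvgeD => //.
by apply: cvg_EFin; [exact: nearW|apply: cvgM => //; exact: cvg_cst].
Qed.

End Lambda.

(** This passes between the integral of [psi] over all of [Rstar], as in the two assumptions, and
    its integral over one sign set. *)
Lemma integral_setI_negligible d (T : measurableType d) (R : realType)
    (mu : {measure set T -> \bar R}) (D S : set T) (f : T -> \bar R) :
  measurable D -> measurable (D `&` S) -> measurable_fun D f ->
  mu (D `\` S) = 0%E ->
  (\int[mu]_(x in D `&` S) f x = \int[mu]_(x in D) f x)%E.
Proof.
move=> mD mDS mf DS0.
rewrite -{1}(setIid D) -setIA integral_mkcondr; apply: ae_eq_integral => //.
  apply/measurable_restrict => //.
  by apply: measurable_funS mf => //; exact: subIsetl.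
exists (D `\` S); split => //.
  rewrite (_ : D `\` S = D `\` (D `&` S)); first exact: measurableD.
  by rewrite setDIr setDv set0U.
move=> x /= nx; apply: contrapT => /not_andP DSx; apply: nx => Dx.
rewrite patchE mem_set//; split=> //.
by apply: contrapT => nSx; case: DSx.
Qed.

(** * Null sets and finiteness for a Lévy measure *)

Section Levy.
Context {R : realType} (nu : {measure set R -> \bar R}).
Hypotheses (nu0 : nu [set 0%R] = 0%E)
  (levy : (\int[nu]_(x in Rstar) (Num.min 1 (x ^+ 2))%:E < +oo)%E).

Lemma measurable_Rstar : measurable (Rstar : set R).
Proof. by apply: measurableC; exact: measurable_set1. Qed.

(** The two assumptions measure sign sets in all of [R], while [psi] is measurable on [Rstar] only.
    The missing piece is empty or the null set [[set 0]], measurable in both cases. *)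
Lemma measure0_Rstar (A : set R) : measurable (Rstar `&` A) ->
  nu (Rstar `&` A) = 0%E -> nu A = 0%E.
Proof.
move=> mA A0.
have -> : A = (Rstar `&` A) `|` ([set 0] `&` A).
  by rewrite -setIUl /Rstar setvU setTI.
apply: measure_negligible.
  apply: measurableU => //; have [A_0|nA_0] := pselect (A 0).
    rewrite (_ : _ `&` _ = [set 0]); first exact: measurable_set1.
    by apply/setIidPl => x ->.
  rewrite (_ : _ `&` _ = set0)//.
  by apply/seteqP; split => x //= [->].
apply: negligibleU; first by exists (Rstar `&` A); split.
by exists [set 0]; split => //; exact: subIsetl.
Qed.

(** Chebyshev's inequality: away from the origin [min(1, x^2)] is at least the positive constant
    [e]. *)
Lemma levy_lt_pinfty (a : R) (A : set R) : 0 < a -> measurable A ->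
  A `<=` [set x | a <= `|x|] -> (nu A < +oo)%E.
Proof.
move=> a0 mA Aa.
have ARstar : A `<=` Rstar.
  by move=> x /Aa /= + x0; rewrite x0 normr0 leNgt a0.
pose e := Num.min 1 (a ^+ 2).
have e0 : 0 < e by rewrite lt_min ltr01 exprn_gt0.
have mmin (B : set R) : measurable_fun B (fun x : R => (Num.min 1 (x ^+ 2))%:E).
  by apply/measurable_EFinP; apply: (@measurable_minr _ _ R B (cst 1) (fun x => x ^+ 2)).
have min_ge0 (x : R) : (0 <= (Num.min 1 (x ^+ 2))%:E)%E.
  by rewrite lee_fin le_min ler01 sqr_ge0.
suff : (e%:E * nu A < +oo)%E.
  have := measure_ge0 nu A; case: (nu A) => [r _ _|_|//]; first exact: ltry.
  by rewrite gt0_muley ?lte_fin.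
rewrite -integral_cst//; apply: le_lt_trans levy.
apply: (@le_trans _ _ (\int[nu]_(x in A) (Num.min 1 (x ^+ 2))%:E)%E).
  apply: ge0_le_integral => //.
  - by move=> x _; rewrite lee_fin ltW.
  - move=> x /Aa /= ax; rewrite lee_fin /e le_min ge_min lexx/= ge_min.
    by rewrite -(real_normK (num_real x)) lerXn2r ?orbT// nnegrE ltW// (lt_le_trans a0).
by apply: ge0_subset_integral => //; exact: measurable_Rstar.
Qed.

End Levy.

(** * Application at a fixed time and scenario *)

Theorem theorem3p1 (R : realType) (T : R) (d : measure_display)
  (Omega : measurableType d) (P : probability Omega R)
  (nu : {measure set R -> \bar R})
  (phi : R -> Omega -> R) (psi : R -> Omega -> R -> R)
  (alpha : R) (C : set R) :
  (0 < T) ->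
  (* Levy measure on R^* *)
  nu [set 0%R] = 0%E ->
  (\int[nu]_(x in Rstar) (Num.min 1 (x ^+ 2))%:E < +oo)%E ->
  (* phi uniformly bounded *)
  (exists K : R, forall t w, t \in `[0, T] -> `|phi t w| <= K) ->
  (* psi uniformly bounded, measurable in x, psi > -1 *)
  (exists K : R, forall t w x, t \in `[0, T] -> x != 0 -> `|psi t w x| <= K) ->
  (forall t w, t \in `[0, T] -> measurable_fun Rstar (psi t w)) ->
  (forall t w x, t \in `[0, T] -> x != 0 -> -1 < psi t w x) ->
  (\int[P]_w \int[lebesgue_measure]_(t in `[0%R, T])
      \int[nu]_(x in Rstar) ((psi t w x) ^+ 2)%:E < +oo)%E ->
  0 < alpha ->
  closed C -> C 0 ->
  (* assumption (1): on T^+ *)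
  (forall t w, t \in `[0, T] -> nu [set x | psi t w x < 0] = 0%E ->
     ((phi t w)%:E < \int[nu]_(x in Rstar) (psi t w x)%:E)%E) ->
  (* assumption (2): on T^- *)
  (forall t w, t \in `[0, T] -> nu [set x | psi t w x > 0] = 0%E ->
     ((phi t w)%:E > \int[nu]_(x in Rstar) (psi t w x)%:E)%E) ->
  forall u : R -> R,
    measurable_fun setT u ->
    (\int[nu]_(x in Rstar) ((u x) ^+ 2)%:E < +oo)%E ->
    (exists M : R, {ae nu, forall x, `|u x| <= M}) ->
  forall t w, t \in `[0, T] ->
    (exists p0, C p0 /\
       forall p, C p -> (lambda_fun nu alpha u (psi t w) (phi t w) p0
                         <= lambda_fun nu alpha u (psi t w) (phi t w) p)%E) /\
    (C = setT -> forall p1 p2,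
       (forall p, (lambda_fun nu alpha u (psi t w) (phi t w) p1
                   <= lambda_fun nu alpha u (psi t w) (phi t w) p)%E) ->
       (forall p, (lambda_fun nu alpha u (psi t w) (phi t w) p2
                   <= lambda_fun nu alpha u (psi t w) (phi t w) p)%E) ->
       p1 = p2).
Proof.
move=> T0 nu0 levy _ [K psi_bnd] mpsi _ _ alpha_gt0 clC C0 hpos hneg u mu_ u2 [M uM].
move=> t w tT; set f := psi t w; set c := phi t w.
have mD := @measurable_Rstar R.
have mf : measurable_fun Rstar f by exact: mpsi.
have mu_D : measurable_fun Rstar u by exact: measurable_funS mu_.
have {}hpos := hpos t w tT; have {}hneg := hneg t w tT.
have mlt : measurable (Rstar `&` [set x | f x < 0]).
  by have /(_ `]-oo, 0[%classic (measurable_itv _)) := mf mD; rewrite preimage_itvNyo.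
have mgt : measurable (Rstar `&` [set x | 0 < f x]).
  by have /(_ `]0, +oo[%classic (measurable_itv _)) := mf mD; rewrite preimage_itvoy.
have mle : measurable (Rstar `&` [set x | f x <= 0]).
  by have /(_ `]-oo, 0]%classic (measurable_itv _)) := mf mD; rewrite preimage_itvNyc.
have mge : measurable (Rstar `&` [set x | 0 <= f x]).
  by have /(_ `[0, +oo[%classic (measurable_itv _)) := mf mD; rewrite preimage_itvcy.
have mEf : measurable_fun Rstar (EFin \o f) by exact/measurable_EFinP.
(* The first condition keeps [E n] away from the origin, hence of finite measure. The second makes
   [u] bounded at every point of [E n], whereas [M] bounds it only almost everywhere. *)
pose E (n : nat) : set R :=
  [set x | n.+1%:R^-1 <= `|x|] `&` [set x | `|u x| <= n%:R].
have mE n : measurable (E n).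
  have ml (g : R -> R) (a : R) : measurable_fun setT g ->
      measurable [set x | g x <= a].
    move=> mg; have /(_ `]-oo, a]%classic (measurable_itv _)) := mg measurableT.
    by rewrite preimage_itvNyc setTI.
  apply: measurableI; last by apply: ml; exact: measurableT_comp.
  rewrite (_ : [set x | _] = [set x : R | - `|x| <= - n.+1%:R^-1]).
    apply: ml; apply: measurableT_comp => //; exact: measurableT_comp.
  by apply/funext => x /=; rewrite lerN2.
have E_fin n : (nu (E n) < +oo)%E.
  by apply: (@levy_lt_pinfty _ _ levy n.+1%:R^-1) => // x [].
have E_mono : {homo E : m n / (m <= n)%N >-> m `<=` n}.
  move=> m n mn x [/= mx ux]; split => /=.
    by apply: le_trans mx; rewrite lef_pV2 ?posrE// ler_nat ltnS.
  by apply: (le_trans ux); rewrite ler_nat.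
have E_cover : \bigcup_n E n = Rstar.
  apply/seteqP; split => x.
    by move=> [n _ [/= nx _]] x0; move: nx; rewrite x0 normr0 leNgt invr_gt0 ltr0n.
  move=> /eqP x0; have x_gt0 : 0 < `|x| by rewrite normr_gt0.
  exists (Num.bound `|u x| + Num.bound `|x|^-1)%N => //; split => /=.
    rewrite -[leRHS]invrK lef_pV2 ?posrE ?invr_gt0//.
    apply/ltW/(lt_le_trans (archi_boundP _)); first by rewrite invr_ge0.
    by rewrite ler_nat; apply: leqW; exact: leq_addl.
  apply/ltW/(lt_le_trans (archi_boundP _)) => //.
  by rewrite ler_nat leq_addr.
have f_bnd x : Rstar x -> `|f x| <= K by move=> /eqP; exact: psi_bnd.
(* The value at [0] is finite because [g_alpha] is at most quadratic on [[-M, M]] and [u] is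
   square-integrable. *)
have G0 : (\int[nu]_(x in Rstar) (g_alpha alpha (u x - 0 * f x))%:E < +oo)%E.
  pose k := expR (alpha * M) * alpha.
  have k0 : 0 <= k by rewrite mulr_ge0 ?expR_ge0 ?ltW.
  have mu2 : measurable_fun Rstar (fun x => (u x ^+ 2)%:E).
    by apply/measurable_EFinP; exact: measurable_funX.
  apply: (@le_lt_trans _ _ (\int[nu]_(x in Rstar) (k%:E * (u x ^+ 2)%:E))%E).
    apply: ae_ge0_le_integral => //.
    - by move=> x _; rewrite lee_fin g_alpha_ge0.
    - exact: measurable_g_alpha.
    - by move=> x _; rewrite -EFinM lee_fin mulr_ge0 ?sqr_ge0.
    - exact: emeasurable_funM.
    - move: uM; apply: filterS => x uxM _.
      by rewrite mul0r subr0 -EFinM lee_fin g_alpha_le_sqr.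
  rewrite ge0_integralZl_EFin//; last by move=> x _; rewrite lee_fin sqr_ge0.
  by rewrite lte_mul_pinfty.
split.
  apply: (@Lambda_has_minimum _ _ _ nu Rstar alpha u f c mD alpha_gt0 mu_D mf
    G0 E K) => //.
  - by move=> n x [].
  - move=> lt0; rewrite integral_setI_negligible//.
      by apply: hpos; exact: measure0_Rstar lt0.
    rewrite -lt0; congr (nu _); apply/seteqP; split => x [Rx /= fx]; split => //=.
      by rewrite ltNge; apply/negP.
    by apply/negP; rewrite -ltNge.
  - move=> gt0; rewrite integral_setI_negligible//.
      by apply: hneg; exact: measure0_Rstar gt0.
    rewrite -gt0; congr (nu _); apply/seteqP; split => x [Rx /= fx]; split => //=.
      by rewrite ltNge; apply/negP.
    by apply/negP; rewrite -ltNge.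
move=> _ p1 p2; apply: Lambda_minimizer_unique => //.
apply/eqP => f0.
(* If [f] vanishes almost everywhere, both strict sign sets are null, and the two assumptions give
   [c < c]. *)
have sub0 S : measurable (Rstar `&` S) -> S `<=` [set x | f x != 0] ->
    nu S = 0%E.
  move=> mS Sf; apply: measure0_Rstar => //; apply: measure_negligible => //.
  exists (Rstar `&` [set x | f x != 0]); split => //; last exact: setIS.
  rewrite (_ : [set x | f x != 0] = f @^-1` [set~ 0]).
    by apply: mf => //; apply: measurableC; exact: measurable_set1.
  by apply/seteqP; split => x /eqP.
have := hpos (sub0 _ mlt (fun x => ltr0_neq0 (x := f x))).
by move=> /lt_trans/(_ (hneg (sub0 _ mgt (fun x => lt0r_neq0 (x := f x))))); rewrite ltxx.
Qed.
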